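(* Let $d\ge1$ and let $G$ be a finite $d$-regular vertex-transitive bipartite graph on $2n$ vertices, and let $m_k(G)$ denote the number of $k$-matchings of $G$. Then $$\frac{m_{n-1}(G)}{m_n(G)}\le\frac2d\,n^2.$$
   Context: Graphs are finite and simple. A graph is vertex-transitive if for all vertices $u,v$ there is an automorphism $\phi$ with $\phi(u)=v$. A $k$-matching is a set of $k$ pairwise vertex-disjoint edges; $m_0(G)=1$. A $d$-regular bipartite graph with $d\ge1$ has a perfect matching, so $m_n(G)>0$. *)

(* Defs.v *)
From mathcomp Require Import all_boot all_order all_algebra all_fingroup.

Set Implicit Arguments.
Unset Strict Implicit.
Unset Printing Implicit Defensive.

(* A finite simple graph is a finType T of vertices with a symmetric and
   irreflexive adjacency relation e : rel T. *)
Section Graphs.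
Variables (T : finType) (e : rel T).

Definition simple_graph : Prop := symmetric e /\ irreflexive e.

Definition regular (d : nat) : Prop := forall x : T, #|[set y | e x y]| = d.

Definition bipartite : Prop :=
  exists A : {set T}, forall x y : T, e x y -> (x \in A) != (y \in A).

Definition automorphism (phi : {perm T}) : Prop :=
  forall x y : T, e (phi x) (phi y) = e x y.

Definition vertex_transitive : Prop :=
  forall u v : T, exists2 phi : {perm T}, automorphism phi & phi u = v.

(* Edges are unordered pairs, encoded as two-element sets. *)
Definition edges : {set {set T}} := [set [set x; y] | x in T, y in e x].

Definition matching (k : nat) (M : {set {set T}}) : bool :=
  [&& M \subset edges, trivIset M & #|M| == k].

Definition num_matchings (k : nat) : nat :=
  #|[set M : {set {set T}} | matching k M]|.

End Graphs.

(* Main.v *)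
(** Write [a] for the number of [n-1]-matchings missing a given vertex; by
    transitivity it does not depend on the vertex, and double counting gives
    [m_(n-1) = n a].  Let [u ~ v], let [M] miss [u] and [N] miss [v], both of
    size [n-1], and exchange [M] and [N] on the component of [u] in their union.
    As [u] and [v] are on opposite sides, [v] lies outside this component, so the
    new [N] misses both [u] and [v]; the total size is preserved, so the new sizes
    are [(n-1, n-1)] or [(n, n-2)].  The exchange is an involution, whence
    [a^2 <= m_(n-1)(G) m_(n-1)(G-u-v) + m_n(G) m_(n-2)(G-u-v)].
    Summing over the [d] neighbours [v] of [u] gives
    [d a^2 <= m_(n-1) m_n + m_n (m_(n-1) - a)], i.e. [d a <= (2n-1) m_n]. *)
Require Import Defs.
From mathcomp Require Import all_boot all_order all_algebra all_fingroup.
From mathcomp Require Import zify ring.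
Import Order.TTheory GRing.Theory Num.Theory.
Local Open Scope ring_scope.

(** * Exchanging two edge families inside a vertex set *)

Section Swap.
Local Open Scope nat_scope.
Set Implicit Arguments.
Unset Strict Implicit.
Variable T : finType.
Implicit Types (M N : {set {set T}}) (C E : {set T}).

Definition swap C M N : {set {set T}} :=
  [set E in M | ~~ (E \subset C)] :|: [set E in N | E \subset C].

Lemma in_swap C M N E :
  (E \in swap C M N) = if E \subset C then E \in N else E \in M.
Proof. by rewrite !inE; case: (E \subset C); rewrite ?andbT ?andbF ?orbF. Qed.

Lemma swapK C M N : swap C (swap C M N) (swap C N M) = M.
Proof. by apply/setP=> E; rewrite !in_swap; case: (E \subset C). Qed.

Lemma swapU C M N : swap C M N :|: swap C N M = M :|: N.
Proof. by apply/setP=> E; rewrite in_setU !in_swap in_setU; case: (E \subset C); rewrite // orbC. Qed.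

Lemma card_swap C M N : #|swap C M N| + #|swap C N M| = #|M| + #|N|.
Proof.
have H M' N' : #|swap C M' N'| =
    #|M' :\: [set E : {set T} | E \subset C]| + #|N' :&: [set E : {set T} | E \subset C]|.
  rewrite -(cardsID [set E : {set T} | E \subset C] (swap C M' N')) addnC.
  congr (_ + _); congr #|pred_of_set _|; apply/setP=> E;
    by rewrite ?in_setI ?in_setD in_swap in_set; case: (E \subset C); rewrite ?andbT ?andbF.
rewrite !H -(cardsID [set E : {set T} | E \subset C] M).
rewrite -(cardsID [set E : {set T} | E \subset C] N).
ring.
Qed.

Definition component u M N : {set T} :=
  [set x | connect (fun y z => [set y; z] \in M :|: N) u x].

Definition swap_component u (p : {set {set T}} * {set {set T}}) :=
  let C := component u p.1 p.2 in (swap C p.1 p.2, swap C p.2 p.1).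

(** The exchange leaves the union [M :|: N] unchanged, hence also the component of [u], so the
    second exchange uses the same set and undoes the first. *)
Lemma swap_componentK u : involutive (swap_component u).
Proof.
move=> [M N]; rewrite /swap_component /=.
suff -> : component u (swap (component u M N) M N) (swap (component u M N) N M)
          = component u M N by rewrite !swapK.
by rewrite {1}/component swapU.
Qed.

(** By closedness an edge kept from [M] is disjoint from [C], whereas an edge taken from [N] lies
    inside [C]; so edges of different origin are disjoint. *)
Lemma trivIset_swap C M N :
    (forall E x, E \in M -> x \in E -> x \in C -> E \subset C) ->
  trivIset M -> trivIset N -> trivIset (swap C M N).
Proof.
move=> closedM /trivIsetP tM /trivIsetP tN; apply/trivIsetP=> E F.
have cross (E' F' : {set T}) : E' \in M -> ~~ (E' \subset C) -> F' \subset C -> [disjoint E' & F'].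
  move=> ME nEC sFC; apply/pred0P=> x /=; apply/negP=> /andP[xE /(subsetP sFC) xC].
  by rewrite (closedM _ _ ME xE xC) in nEC.
rewrite !in_swap; case: ifP => EC; case: ifP => FC XE XF ne.
- exact: tN.
- by rewrite disjoint_sym; apply: cross; rewrite ?FC.
- by apply: cross; rewrite ?EC.
- exact: tM.
Qed.

End Swap.

(** * Matchings in a simple graph and alternating components *)

Section Matchings.
Local Open Scope nat_scope.
Set Implicit Arguments.
Unset Strict Implicit.
Variables (T : finType) (e : rel T).
Hypothesis e_simple : simple_graph e.
Implicit Types (M N : {set {set T}}) (C E : {set T}).

Lemma edgesP E : reflect (exists x y, e x y /\ E = [set x; y]) (E \in edges e).
Proof.
apply: (iffP imset2P) => [[x y _ exy ->]|[x [y [exy ->]]]]; last by exists x y.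
by exists x, y.
Qed.

Lemma mem_edges x y : ([set x; y] \in edges e) = e x y.
Proof.
have [e_sym _] := e_simple.
apply/edgesP/idP => [[a [b [eab /setP eq_ab]]]|exy]; last by exists x, y.
have [_ e_irr] := e_simple.
have := eq_ab b; have := eq_ab a; rewrite !inE !eqxx ?orbT /=.
move=> /orP[]/eqP ax /orP[]/eqP bx; move: eab;
  by rewrite ax bx ?e_irr // e_sym.
Qed.

Lemma card_edge E : E \in edges e -> #|E| = 2.
Proof.
have [_ e_irr] := e_simple.
move=> /edgesP[x [y [exy ->]]]; rewrite cards2.
by case: eqP exy => // ->; rewrite e_irr.
Qed.

Lemma card_cover_matching k M : matching e k M -> #|cover M| = 2 * k.
Proof.
move=> /and3P[/subsetP sM /eqP tM /eqP <-].
rewrite -tM mulnC -sum_nat_const; apply: eq_bigr => E ME.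
by rewrite card_edge ?sM.
Qed.

Lemma matching_eq M E F x : trivIset M ->
  E \in M -> F \in M -> x \in E -> x \in F -> E = F.
Proof.
move=> /trivIsetP tM ME MF xE xF; apply/eqP/negPn/negP=> /(tM _ _ ME MF)/pred0P/(_ x).
by rewrite /= xE xF.
Qed.

Lemma mem_cover M E x : E \in M -> x \in E -> x \in cover M.
Proof. by move=> ME xE; apply/bigcupP; exists E. Qed.

Lemma component_closed u M N E x :
    M \subset edges e -> N \subset edges e -> E \in M :|: N ->
  x \in E -> x \in component u M N -> E \subset component u M N.
Proof.
move=> /subsetP sM /subsetP sN ME xE; rewrite inE => ux.
have /edgesP[y [z [_ defE]]] : E \in edges e.
  by move: ME; rewrite inE => /orP[/sM|/sN].
apply/subsetP=> w wE; rewrite inE.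
have [<- // | nxw] := eqVneq x w.
apply: connect_trans ux _; apply: connect1.
suff -> : [set x; w] = E by [].
move: xE wE nxw; rewrite defE !inE => /orP[]/eqP-> /orP[]/eqP->; rewrite ?eqxx //.
by rewrite setUC.
Qed.

(* Alternating walks from [u] leave the side of [u] along [N] and return to it
   along [M], so they reach a vertex of the other side only through an edge of [N]. *)
Lemma component_avoid (A : {set T}) u v M N :
    (forall x y, e x y -> (x \in A) != (y \in A)) -> e u v ->
    M \subset edges e -> N \subset edges e -> trivIset M -> trivIset N ->
    u \notin cover M -> v \notin cover N ->
  v \notin component u M N.
Proof.
have [e_sym e_irr] := e_simple.
move=> bipA euv sM sN tM tN uM vN.
pose side x := (x \in A) == (u \in A).
pose r x y := [set x; y] \in if side x then N else M.
have sideE x y : e x y -> side y = ~~ side x.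
  by move=> /bipA; rewrite /side; do 3 case: (_ \in A).
have rE x y : r x y -> e x y.
  by rewrite -mem_edges /r; case: ifP => _; apply/subsetP.
pose D := [set x | connect r u x].
have last_step x : x \in D -> x = u \/ exists2 y, y \in D & r y x.
  rewrite inE => /connectP[p]; elim/last_ind: p => [_ ->|p z _]; first by left.
  rewrite rcons_path last_rcons => /andP[up pz] ->; right.
  by exists (last u p) => //; rewrite inE; apply/connectP; exists p.
have D_step x y : x \in D -> r x y -> y \in D.
  by rewrite !inE => ux xy; apply: connect_trans ux (connect1 xy).
(* An edge of the wrong matching leads nowhere new: at [u] there is none, as [M] misses [u]; at any
   other [x] the walk entered along an edge [[set z; x]] of that same matching, so [y] is the
   predecessor [z]. *)
have D_back x y : x \in D -> [set x; y] \in (if side x then M else N) -> y \in D.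
  move=> xD xy; case: (last_step x xD) => [xu|[z zD zx]].
    move: xy; rewrite xu /side eqxx => xy.
    by case/negP: uM; apply: mem_cover xy _; rewrite !inE eqxx.
  have ezx := rE _ _ zx.
  have Ezx : [set z; x] = [set x; y].
    have xzx : x \in [set z; x] by rewrite !inE eqxx orbT.
    have xxy : x \in [set x; y] by rewrite !inE eqxx.
    move: zx xy; rewrite /r (sideE _ _ ezx); case: (side z) => /= zx xy.
      exact: matching_eq tN zx xy xzx xxy.
    exact: matching_eq tM zx xy xzx xxy.
  have : z \in [set x; y] by rewrite -Ezx !inE eqxx.
  move=> /set2P[zx'|<- //].
  by move: ezx; rewrite zx' e_irr.
have sub : component u M N \subset D.
  apply/subsetP=> z; rewrite inE => /connectP[p + ->].
  have: u \in D by rewrite inE.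
  elim: p {1 2 3}u => //= y p IH w wD /andP[wy]; apply: IH.
  move: wy; rewrite inE; case sw: (side w) => /orP[wy|wy].
  - by apply: (D_back w) => //; rewrite sw.
  - by apply: (D_step w) => //; rewrite /r sw.
  - by apply: (D_step w) => //; rewrite /r sw.
  - by apply: (D_back w) => //; rewrite sw.
apply/negP=> /(subsetP sub) /last_step[vu|[y _ yv]].
  by move: euv; rewrite vu e_irr.
have side_y : side y.
  have := sideE _ _ (rE _ _ yv); rewrite (sideE _ _ euv) /side eqxx /=.
  by case: (_ == _).
case/negP: vN; move: yv; rewrite /r side_y => yv.
by apply: mem_cover yv _; rewrite !inE eqxx orbT.
Qed.

(** * Counting matchings that miss prescribed vertices *)

Definition matchings k : {set {set {set T}}} := [set M : {set {set T}} | matching e k M].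

Definition missing k (u : T) : {set {set {set T}}} :=
  [set M : {set {set T}} in matchings k | u \notin cover M].

(* The size is shifted so that [missing2 0 u v] is empty. *)
Definition missing2 k (u v : T) : {set {set {set T}}} :=
  [set M : {set {set T}} | [&& matching e #|M| M, #|M|.+1 == k, u \notin cover M & v \notin cover M]].

(** The exchange is injective and lands in the union of two products, one for each possible pair of
    new sizes. With [2 * n.+1] vertices, [matchings n.+1] are the perfect matchings, and
    [missing2 n.+1] consists of matchings of size [n]. *)
Lemma card_missing_mul n (A : {set T}) u v :
    (forall x y, e x y -> (x \in A) != (y \in A)) -> e u v -> #|T| = 2 * n.+1 ->
  #|missing n u| * #|missing n v| <=
    #|matchings n| * #|missing2 n.+1 u v| + #|matchings n.+1| * #|missing2 n u v|.
Proof.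
move=> bipA euv cT.
rewrite -!cardsX -(card_imset _ (inv_inj (@swap_componentK T u))).
apply: leq_trans (leq_card_setU _ _); apply/subset_leq_card/subsetP=> q.
move=> /imsetP[[M N] /setXP[/= + +] ->{q}].
rewrite !inE => /andP[/and3P[sM tM /eqP cM] uM] /andP[/and3P[sN tN /eqP cN] vN].
rewrite /swap_component /=; set C := component u M N.
have uC : u \in C by rewrite inE.
have vC : v \notin C by exact: component_avoid bipA euv sM sN tM tN uM vN.
have closedM E x : E \in M -> x \in E -> x \in C -> E \subset C.
  by move=> ME; apply: component_closed; rewrite // inE ME.
have closedN E x : E \in N -> x \in E -> x \in C -> E \subset C.
  by move=> NE; apply: component_closed; rewrite // inE NE orbT.
have edge_swap M' N' : M' \subset edges e -> N' \subset edges e ->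
    swap C M' N' \subset edges e.
  move=> /subsetP sM' /subsetP sN'; apply/subsetP=> E; rewrite in_swap.
  by case: ifP => _; [apply: sN' | apply: sM'].
have mM : matching e #|swap C M N| (swap C M N).
  by rewrite /matching eqxx edge_swap ?trivIset_swap.
have mN : matching e #|swap C N M| (swap C N M).
  by rewrite /matching eqxx edge_swap ?trivIset_swap.
have uN' : u \notin cover (swap C N M).
  apply/bigcupP=> -[E]; rewrite in_swap; case: ifP => EC EX uE.
    by case/negP: uM; apply: mem_cover EX uE.
  by rewrite (closedN _ _ EX uE uC) in EC.
have vN' : v \notin cover (swap C N M).
  apply/bigcupP=> -[E]; rewrite in_swap; case: ifP => EC EX vE.
    by case/negP: vC; apply: (subsetP EC).
  by case/negP: vN; apply: mem_cover EX vE.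
(* The new sizes add up to [2 * n]. The first is at most [n.+1], the second at most [n] because [u]
   stays uncovered; only (n, n) and (n+1, n-1) remain. *)
have le1 : #|swap C M N| <= n.+1.
  have := max_card (mem (cover (swap C M N))).
  by rewrite (card_cover_matching mM) cT leq_mul2l.
have le2 : #|swap C N M| <= n.
  have : #|cover (swap C N M)| < #|T|.
    rewrite -cardsT; apply: proper_card; apply/properP; split; first exact: subsetT.
    by exists u.
  by rewrite (card_cover_matching mN) cT ltn_mul2l.
have := card_swap C M N; rewrite cM cN => sz.
rewrite uN' vN' mN !andbT /=.
move: mM; rewrite /matching => /and3P[-> -> _] /=.
move: sz le1 le2; move: #|swap C M N| #|swap C N M| => a b; lia.
Qed.

(** Adding the edge [[set u; v]] to a matching missing both ends gives a [k]-matching covering [u].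
    This is injective in the pair of [v] and the matching, since the added edge is the only one at
    [u]. *)
Lemma sum_missing2 k u :
  \sum_(v | e u v) #|missing2 k u v| <=
    #|[set M : {set {set T}} in matchings k | u \in cover M]|.
Proof.
pose P := [set p : T * {set {set T}} | e u p.1 & p.2 \in missing2 k u p.1].
pose f (p : T * {set {set T}}) := [set u; p.1] |: p.2.
have -> : \sum_(v | e u v) #|missing2 k u v| = #|P|.
  rewrite -sum1_card; under eq_bigr do rewrite -sum1_card.
  rewrite pair_big_dep /=; by apply: eq_bigl => p; rewrite [RHS]inE.
have [_ e_irr] := e_simple.
have u_edge v M E : u \notin cover M -> E \in f (v, M) -> (u \in E) = (E == [set u; v]).
  move=> uM; rewrite !inE; case: eqP => [-> _|_ /= ME]; first by rewrite !inE eqxx.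
  by apply: contraNF uM; apply: mem_cover.
have f_inj : {in P &, injective f}.
  move=> [v M] [w N]; rewrite !inE /= => /andP[euv /and4P[_ _ uM _]].
  move=> /andP[euw /and4P[_ _ uN _]] eq_f.
  (* The matching is recovered by deleting the edge at [u]; that edge then determines [v]. *)
  have defM v' M' : u \notin cover M' -> M' = [set E in f (v', M') | u \notin E].
    move=> uM'; apply/setP=> E; rewrite inE; apply/idP/andP => [ME|[EX]].
      rewrite !inE ME orbT; split=> //.
      by apply: contra uM'; apply: mem_cover.
    rewrite (u_edge _ _ _ uM' EX); move: EX; rewrite !inE.
    by case: eqP.
  have -> : M = N by rewrite (defM v M uM) eq_f -defM.
  have : [set u; v] \in f (w, N) by rewrite -eq_f !inE eqxx.
  move=> /(u_edge _ _ _ uN); rewrite !inE eqxx => /esym/eqP/setP/(_ v).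
  rewrite !inE eqxx orbT => /esym/orP[]/eqP vE; last by rewrite vE.
  by move: euv; rewrite vE e_irr.
rewrite -(card_in_imset f_inj); apply/subset_leq_card/subsetP=> _ /imsetP[[v M] + ->].
rewrite !inE /= => /andP[euv /and4P[/and3P[sM tM _] /eqP <- uM vM]].
have disj E : E \in M -> [disjoint [set u; v] & E].
  move=> ME; apply/pred0P=> x /=; apply/negP=> /andP[]; rewrite !inE.
  move=> /orP[]/eqP-> xE; [case/negP: uM | case/negP: vM]; exact: mem_cover ME xE.
apply/andP; split; last first.
  by apply: (@mem_cover _ [set u; v]); rewrite !inE eqxx.
rewrite /matching /f /=; apply/and3P; split.
- by rewrite subUset sub1set mem_edges euv.
- apply/trivIsetP=> E F; rewrite !inE => /orP[/eqP->|ME] /orP[/eqP->|MF] ne.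
  + by rewrite eqxx in ne.
  + exact: disj.
  + by rewrite disjoint_sym disj.
  + by move/trivIsetP: tM; apply.
- rewrite cardsU1; case: (boolP (_ \in M)) => // uvM.
  by case/negP: uM; apply: mem_cover uvM _; rewrite !inE eqxx.
Qed.

(** Taking images of edges under [phi] is an injection between the two families. *)
Lemma leq_card_missing k u v phi : automorphism e phi -> phi u = v ->
  #|missing k u| <= #|missing k v|.
Proof.
move=> aut <-.
pose f M : {set {set T}} := [set phi @: E | E : {set T} in M].
have inj_phi : injective (fun E : {set T} => phi @: E) by apply/imset_inj/perm_inj.
have f_inj : injective f by exact: imset_inj.
rewrite -(card_imset _ f_inj); apply/subset_leq_card/subsetP=> _ /imsetP[M + ->].
rewrite !inE => /andP[/and3P[/subsetP sM /trivIsetP tM /eqP <-] uM].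
apply/andP; split; last first.
  apply/bigcupP=> -[_ /imsetP[E ME ->]]; rewrite mem_imset; last exact: perm_inj.
  by move=> uE; case/negP: uM; apply: mem_cover ME uE.
apply/and3P; split; last by rewrite card_imset.
- apply/subsetP=> _ /imsetP[E /sM/edgesP[x [y [exy ->]]] ->].
  by rewrite imsetU1 imset_set1 mem_edges aut.
- apply/trivIsetP=> _ _ /imsetP[E ME ->] /imsetP[F MF ->] ne.
  rewrite imset_disjoint; first by apply: tM => //; apply: contra_neq ne => ->.
  exact: perm_inj.
Qed.

(** Double counting of pairs of a vertex and a matching missing it: each [k]-matching misses exactly
    two vertices. *)
Lemma sum_card_missing k : #|T| = 2 * k.+1 ->
  \sum_u #|missing k u| = 2 * #|matchings k|.
Proof.
move=> cT.
have -> : \sum_u #|missing k u| = \sum_u \sum_(M in matchings k | u \notin cover M) 1.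
  by apply: eq_bigr => u _; rewrite -sum1_card; apply: eq_bigl => M; rewrite [LHS]inE.
rewrite (exchange_big_dep (mem (matchings k))) /=; last by move=> ? ? _ /andP[].
rewrite mulnC -sum_nat_const; apply: eq_bigr => M mM.
transitivity #|~: cover M|.
  by rewrite -sum1_card; apply: eq_bigl => u; rewrite mM inE.
move: mM; rewrite inE => /card_cover_matching cM.
by rewrite cardsCs setCK cM cT -mulnBr subSnn.
Qed.

End Matchings.

(** * Summation over the neighbours of a vertex and the final estimate *)

Theorem theorem1p10 (T : finType) (e : rel T) (d n : nat)
    (e_simple : simple_graph e)
    (d_gt0 : (1 <= d)%N)
    (n_gt0 : (1 <= n)%N)
    (card_T : #|T| = (2 * n)%N)
    (e_regular : regular e d)
    (e_transitive : vertex_transitive e)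
    (e_bipartite : bipartite e) :
  (num_matchings e (n - 1))%:R / (num_matchings e n)%:R
    <= 2 / d%:R * n%:R ^+ 2 :> rat.
Proof.
case: n n_gt0 card_T => // n _ card_T; rewrite subn1 /=.
rewrite /num_matchings -/(matchings e n) -/(matchings e n.+1).
set m := #|matchings e n|; set p := #|matchings e n.+1|.
have [u _] : exists u : T, u \in T by apply/card_gt0P; rewrite card_T.
pose a := #|missing e n u|.
have missingE v : #|missing e n v| = a.
  apply/eqP; rewrite eqn_leq.
  have [phi aut_phi phiE] := e_transitive v u.
  have [psi aut_psi psiE] := e_transitive u v.
  by rewrite (leq_card_missing e_simple n aut_phi phiE)
             (leq_card_missing e_simple n aut_psi psiE).
have mE : m = (n.+1 * a)%N.
  have := sum_card_missing e_simple card_T.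
  under eq_bigr do rewrite missingE.
  by rewrite sum_nat_const card_T -mulnA => /eqP; rewrite eqn_mul2l => /eqP.
have [A bipA] := e_bipartite.
(* The term [p * a] stands on the left to avoid a truncated subtraction [m - a]; it comes from
   [le2], where the matchings counted by [m] are split according to whether they cover [u]. *)
have main : (d * a * a + p * a <= 2 * m * p)%N.
  have sum1 := sum_missing2 e_simple n.+1 u.
  have sum2 := sum_missing2 e_simple n u.
  have le1 : (\sum_(v | e u v) #|missing2 e n.+1 u v| <= p)%N.
    apply: leq_trans sum1 _; apply/subset_leq_card/subsetP=> M.
    by rewrite inE => /andP[].
  have le2 : (\sum_(v | e u v) #|missing2 e n u v| + a <= m)%N.
    apply: leq_trans (leq_add sum2 (leqnn a)) _.
    rewrite /m -(cardsID [set M | u \in cover M] (matchings e n)).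
    by apply: leq_add; apply/subset_leq_card/subsetP=> M; rewrite !inE // andbC.
  have : (\sum_(v | e u v) a * a <= \sum_(v | e u v)
      (m * #|missing2 e n.+1 u v| + p * #|missing2 e n u v|))%N.
    apply: leq_sum => v euv.
    by have := card_missing_mul e_simple bipA euv card_T; rewrite !missingE.
  have cd : #|[pred v | e u v]| = d.
    by rewrite -(e_regular u); apply: eq_card => v; rewrite !inE.
  rewrite sum_nat_const cd big_split -!big_distrr /= => le3.
  rewrite -mulnA; apply: leq_trans (leq_add le3 (leqnn _)) _.
  rewrite -addnA -mulnDr mul2n -addnn mulnDl.
  by apply: leq_add; rewrite ?leq_mul2l ?le1 ?orbT // mulnC leq_mul2r le2 orbT.
have bound : (m * d <= 2 * n.+1 ^ 2 * p)%N.
  have [a0|a_gt0] := posnP a; first by rewrite mE a0 muln0.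
  rewrite mE -(leq_pmul2r a_gt0).
  (* Dropping [p * a] relaxes the factor 2n-1 to 2n, with [n.+1] in the role of n; multiplying by
     [n.+1] turns one factor [a] into [m]. *)
  have /leq_trans main' : (d * a * a <= d * a * a + p * a)%N by apply: leq_addr.
  have := main' _ main; rewrite mE -(leq_pmul2l (ltn0Sn n)).
  move=> H; apply: leq_trans (leq_trans _ H) _; apply: eq_leq; ring.
(* Division by zero is 0 in [rat], so for [p = 0] the left side vanishes. *)
have [p0|p_gt0] := posnP p.
  by rewrite p0 invr0 mulr0 mulr_ge0 ?exprn_ge0 ?divr_ge0 ?ler0n.
rewrite ler_pdivrMr ?ltr0n // mulrAC -mulrA mulrAC ler_pdivlMr ?ltr0n //.
by rewrite [p%:R * _]mulrC mulrA -natrX -!natrM ler_nat.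
Qed.
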